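(* Let $\kappa,\kappa'\in\mathbb{C}^*$ be arbitrary and $\epsilon,\epsilon'\in\{+,-\}$. Let ${}_{\mathsf n}\langle P,\kappa,\epsilon|$ be an eigenstate of the twisted antiperiodic transfer matrix $\mathcal T_K(\lambda)$ with twist $K=\mathrm{diag}(\kappa,\kappa^{-1})\cdot\sigma^x$, with eigenvalue $\epsilon\tau_P(\lambda)$, and let $|Q,\kappa',\epsilon'\rangle_{\mathsf n}$ be an eigenstate of the transfer matrix $\mathcal T_{K'}(\lambda)$ with twist $K'=\mathrm{diag}(\kappa',\kappa'^{-1})\cdot\sigma^x$, with eigenvalue $\epsilon'\tau_Q(\lambda)$. Let $p_1,\ldots,p_N$ be the roots of $P$, $P(\lambda)=\prod_{j=1}^N\sinh(\frac{\lambda-p_j}{2})$. Then the overlap of these two eigenstates can be expressed as $$\mathbf S(PQ,\epsilon\epsilon'\kappa'/\kappa)=\frac{\det_{1\le i,k\le N}\left[\frac{\tau_Q(\xi_i)}{\sinh(\xi_i-p_k)}-\frac{\kappa'}{\kappa}\frac{\tau_P(\xi_i)}{\sinh(\xi_i-p_k-\eta)}\right]}{\det_{1\le i,k\le N}\left[\frac{\tau_Q(\xi_i)}{\sinh(\xi_i-p_k)}\right]}.$$ It can be rewritten as $$\mathbf S(PQ,\epsilon\epsilon'\kappa'/\kappa)=\frac{\prod_{i,j=1}^N\left[\sinh(z_i-\xi_j)\sinh(\xi_j-p_i)\right]\ \det_N\left[\mathcal S^{(\kappa'/\kappa)}_{\tau_Q,\tau_P}(\mathbf z\,|\,\mathbf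 p)\right]}{e^{\sum_\ell\xi_\ell}\,\prod_{j=1}^N\tau_Q(\xi_j)\,\prod_{i<j}\left[\sinh(z_j-z_i)\sinh(p_i-p_j)\right]},$$ in which $z_1,\ldots,z_N$ are arbitrary parameters and, with $\hat\tau_P(\lambda)=e^\lambda\frac{\tau_P(\lambda)}{d(\lambda)}$ and $\hat\tau_Q(\lambda)=e^\lambda\frac{\tau_Q(\lambda)}{d(\lambda)}$, $$\left[\mathcal S^{(\alpha)}_{\tau_Q,\tau_P}(\mathbf z\,|\,\mathbf p)\right]_{i,k}=\frac{\hat\tau_Q(z_i)-\hat\tau_Q(p_k)}{\sinh(z_i-p_k)}-\alpha\,\frac{\hat\tau_P(z_i)-\hat\tau_P(p_k+\eta)}{\sinh(z_i-p_k-\eta)},\qquad 1\le i,k\le N.$$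
   Context: $N\ge 1$ is an integer; $\eta\in\mathbb{C}$ is not commensurate with $i\pi$; $\xi_1,\ldots,\xi_N\in\mathbb{C}$ are such that the sets $\Xi_i=\{\xi_i+k\eta+ik'\pi\mid k\in\{0,-1\},\,k'\in\mathbb{Z}\}$ satisfy $\Xi_i\cap\Xi_j=\emptyset$ for $i\ne j$. Set $a(\lambda)=\prod_{n=1}^N\sinh(\lambda-\xi_n+\eta)$, $d(\lambda)=\prod_{n=1}^N\sinh(\lambda-\xi_n)$, $\xi_n^{(h)}=\xi_n-h\eta$ for $h\in\{0,1\}$, $V(x_1,\ldots,x_N)=\prod_{i<j}\sinh(x_j-x_i)$. Signs $\epsilon,\epsilon'$ are identified with $\pm1$ in formulas. Transfer matrix: $\mathcal T_K(\lambda)=\mathrm{tr}_0[K_0R_{0,N}(\lambda-\xi_N)\cdots R_{0,1}(\lambda-\xi_1)]$ on $\mathcal H=(\mathbb{C}^2)^{\otimes N}$, where $0$ labels an auxiliary space $\mathbb{C}^2$, $\sigma^x$ is the Pauli matrix, and $R(\lambda)=\begin{pmatrix}\sinh(\lambda+\eta)&0&0&0\\0&\sinh\lambda&\sinh\eta&0\\0&\sinh\eta&\sinh\lambda&0\\0&0&0&\sinh(\lambda+\eta)\end{pmatrix}$. Write $R_{0,N}(\lambda-\xi_N)\cdots R_{0,1}(\lambda-\xi_1)=\begin{pmatrix}A(\lambda)&B(\lambda)\\C(\lambda)&D(\lambda)\end{pmatrix}_{[0]}$. Separation-of-variables bases: there exist a basis $\{\langle\mathbf h|\}$ of $\mathcal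 H^*$ and a basis $\{|\mathbf h\rangle\}$ of $\mathcal H$, $\mathbf h\in\{0,1\}^N$, such that $\langle\mathbf h|\mathbf k\rangle=\delta_{\mathbf h,\mathbf k}/V(\xi_1^{(h_1)},\ldots,\xi_N^{(h_N)})$ and $$\langle\mathbf h|D(\lambda)=\prod_n\sinh(\lambda-\xi_n^{(h_n)})\langle\mathbf h|,\quad \langle\mathbf h|C(\lambda)=\sum_{a=1}^N\prod_{b\ne a}\frac{\sinh(\lambda-\xi_b^{(h_b)})}{\sinh(\xi_a^{(h_a)}-\xi_b^{(h_b)})}\delta_{h_a,0}\,d(\xi_a^{(1)})\langle\mathrm T_a^+\mathbf h|,$$ $$\langle\mathbf h|B(\lambda)=-\sum_{a=1}^N\prod_{b\ne a}\frac{\sinh(\lambda-\xi_b^{(h_b)})}{\sinh(\xi_a^{(h_a)}-\xi_b^{(h_b)})}\delta_{h_a,1}\,a(\xi_a^{(0)})\langle\mathrm T_a^-\mathbf h|,$$ $$D(\lambda)|\mathbf h\rangle=\prod_n\sinh(\lambda-\xi_n^{(h_n)})|\mathbf h\rangle,\quad C(\lambda)|\mathbf h\rangle=\sum_{a=1}^N\prod_{b\ne a}\frac{\sinh(\lambda-\xi_b^{(h_b)})}{\sinh(\xi_a^{(h_a)}-\xi_b^{(h_b)})}\delta_{h_a,1}\,d(\xi_a^{(1)})|\mathrm T_a^-\mathbf h\rangle,$$ $$B(\lambda)|\mathbf h\rangle=-\sum_{a=1}^N\prod_{b\ne a}\frac{\sinh(\lambda-\xi_b^{(h_b)})}{\sinh(\xi_a^{(h_a)}-\xi_b^{(h_b)})}\delta_{h_a,0}\,a(\xi_a^{(0)})|\mathrm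 T_a^+\mathbf h\rangle,$$ where $\mathrm T_a^\pm\mathbf h$ is $\mathbf h$ with $h_a$ replaced by $h_a\pm1$. Separate states: $${}_{\mathsf n}\langle P,\kappa,\epsilon|=\sum_{\mathbf h}\prod_{n}\left(\frac{\epsilon}{\kappa}\frac{P(\xi_n)}{P(\xi_n-\eta)}\right)^{1-h_n}V(\xi_1^{(h_1)},\ldots,\xi_N^{(h_N)})\langle\mathbf h|,$$ $$|Q,\kappa',\epsilon'\rangle_{\mathsf n}=\sum_{\mathbf h}\prod_n\left(\epsilon'\kappa'\frac{Q(\xi_n)}{Q(\xi_n-\eta)}\right)^{1-h_n}\frac{V(\xi_1^{(1-h_1)},\ldots,\xi_N^{(1-h_N)})}{V(\xi_1,\ldots,\xi_N)}|\mathbf h\rangle,$$ so that, with $\alpha=\epsilon\epsilon'\kappa'/\kappa$, $$\mathbf S(PQ,\alpha)={}_{\mathsf n}\langle P,\kappa,\epsilon|Q,\kappa',\epsilon'\rangle_{\mathsf n}=\sum_{\mathbf h}\prod_{n=1}^N\left[\alpha\frac{(PQ)(\xi_n)}{(PQ)(\xi_n-\eta)}\right]^{1-h_n}\frac{V(\xi_1^{(1-h_1)},\ldots,\xi_N^{(1-h_N)})}{V(\xi_1,\ldots,\xi_N)}.$$ Here $P(\lambda)=\prod_{j=1}^N\sinh(\frac{\lambda-p_j}2)$ and $Q(\lambda)=\prod_{j=1}^N\sinh(\frac{\lambda-q_j}2)$. The eigenvalues of the transfer matrix (the same set for every twist parameter) are entire functions $\tau$ of $\lambda$ with $\tau(\lambda+i\pi)=(-1)^{N-1}\tau(\lambda)$.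 The identities are understood for parameters such that no denominator vanishes.
   Formalization: Both determinants use εε'κ'/κ instead of κ'/κ (the printed form fails for ε=-ε', already for N=1), and P is assumed to solve Baxter's equation τ_P(λ)P(λ)=-a(λ)P(λ-η)+d(λ)P(λ+η), since for exceptional ξ, η other P give the same eigenstate but a wrong formula. *)

(* Defs.v *)
From HB Require Import structures.
From mathcomp Require Import all_boot all_order all_algebra.
From mathcomp Require Import complex.
From mathcomp Require Import classical_sets reals sequences exp trigo.

Set Implicit Arguments.
Unset Strict Implicit.
Unset Printing Implicit Defensive.

Import Order.TTheory GRing.Theory Num.Theory.

Local Open Scope ring_scope.

Section ComplexFunctions.
Variable R : realType.

Definition cexp (z : R[i]) : R[i] :=
  real_complex R (expR (complex.Re z)) * Complex (cos (complex.Im z)) (sin (complex.Im z)).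

Definition csinh (z : R[i]) : R[i] := (cexp z - cexp (- z)) / 2%:R.

Definition ipi : R[i] := Complex 0 pi.

End ComplexFunctions.

(* Spin configurations: a label of the canonical basis of (C^2)^{(x) N}, and
   also a label of the separation-of-variables bases.  In each C^2 the value 0
   of 'I_2 labels the first canonical basis vector. *)
Definition config (N : nat) : finType := {ffun 'I_N -> 'I_2}.

Section Chain.
Variables (R : realType) (N : nat) (eta : R[i]) (xi : 'I_N -> R[i]).
Local Notation C := R[i].
Local Notation sinh := (@csinh R).

Definition commensurate_ipi : Prop :=
  exists m n : int, m != 0 /\ eta *~ m = ipi R *~ n.

Definition Xi (i : 'I_N) : set C :=
  [set x | exists k k' : int,
     (k = 0 \/ k = -1) /\ x = xi i + eta *~ k + ipi R *~ k']%classic.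

Definition afun (lambda : C) : C := \prod_(n < N) sinh (lambda - xi n + eta).
Definition dfun (lambda : C) : C := \prod_(n < N) sinh (lambda - xi n).

Definition xih (n : 'I_N) (h : nat) : C := xi n - eta *+ h.

Definition V (x : 'I_N -> C) : C :=
  \prod_(i < N) \prod_(j < N | (i < j)%N) sinh (x j - x i).

Definition Vh (h : config N) : C := V (fun n => xih n (h n)).
Definition Vh_compl (h : config N) : C := V (fun n => xih n (1 - h n)%N).

(* Operators on a space with basis labelled by a finite type T are matrices of
   size #|T|, rows and columns being numbered by enum_rank. *)
Definition opmx (T : finType) (f : T -> T -> C) : 'M[C]_#|T| :=
  \matrix_(i, j) f (enum_val i) (enum_val j).

Definition Rmx (lambda : C) : 'M[C]_4 :=
  let u := sinh (lambda + eta) in let v := sinh lambda in let w := sinh eta in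
  \matrix_(i, j) nth 0 (nth [::] [:: [:: u; 0; 0; 0];
                                     [:: 0; v; w; 0];
                                     [:: 0; w; v; 0];
                                     [:: 0; 0; 0; u]] i) j.

(* Position of e_a (x) e_s in the basis of C^2 (x) C^2. *)
Definition pair4 (a s : 'I_2) : 'I_4 := inord (2 * a + s)%N.

(* Auxiliary space (label 0) tensor quantum space: the basis is labelled by
   'I_2 * config N. *)
Definition R0 (n : 'I_N) (lambda : C) : 'M[C]_#|{: 'I_2 * config N}| :=
  opmx (fun x y : 'I_2 * config N =>
    Rmx lambda (pair4 x.1 (x.2 n)) (pair4 y.1 (y.2 n))
    *+ [forall m, (m != n) ==> (x.2 m == y.2 m)]).

(* R_{0,N}(lambda - xi_N) ... R_{0,1}(lambda - xi_1), in decreasing order of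
   the sites from left to right. *)
Definition monodromy (lambda : C) : 'M[C]_#|{: 'I_2 * config N}| :=
  \big[mulmx/1%:M]_(n <- rev (enum 'I_N)) R0 n (lambda - xi n).

Definition aux_block (a b : 'I_2) (X : 'M[C]_#|{: 'I_2 * config N}|)
    : 'M[C]_#|config N| :=
  opmx (fun s t : config N => X (enum_rank (a, s)) (enum_rank (b, t))).

Definition Bop (lambda : C) := aux_block ord0 ord_max (monodromy lambda).
Definition Cop (lambda : C) := aux_block ord_max ord0 (monodromy lambda).
Definition Dop (lambda : C) := aux_block ord_max ord_max (monodromy lambda).

Definition tr0 (X : 'M[C]_#|{: 'I_2 * config N}|) : 'M[C]_#|config N| :=
  \sum_(a < 2) aux_block a a X.

Definition K0 (K : 'M[C]_2) : 'M[C]_#|{: 'I_2 * config N}| :=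
  opmx (fun x y : 'I_2 * config N => K x.1 y.1 *+ (x.2 == y.2)).

Definition transfer (K : 'M[C]_2) (lambda : C) : 'M[C]_#|config N| :=
  tr0 (K0 K *m monodromy lambda).

Definition sigmax : 'M[C]_2 := \matrix_(i, j) (i != j)%:R.

Definition twist (kappa : C) : 'M[C]_2 :=
  diag_mx (\row_j (if j == 0 then kappa else kappa^-1)) *m sigmax.

(* H is the space of column vectors and its dual the space of row vectors; the
   pairing is the entry of the 1 x 1 product. *)
Definition pairing (f : 'rV[C]_#|config N|) (v : 'cV[C]_#|config N|) : C :=
  (f *m v) 0 0.

Definition left_eigenstate (T : C -> 'M[C]_#|config N|)
    (f : 'rV[C]_#|config N|) (tau : C -> C) : Prop :=
  f != 0 /\ forall lambda, f *m T lambda = tau lambda *: f.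

Definition right_eigenstate (T : C -> 'M[C]_#|config N|)
    (v : 'cV[C]_#|config N|) (tau : C -> C) : Prop :=
  v != 0 /\ forall lambda, T lambda *m v = tau lambda *: v.

(* T_a^+ h and T_a^- h: they occur only with the factors delta_{h_a,0} and
   delta_{h_a,1} respectively, so the junk values for h_a = 1 and h_a = 0 are
   irrelevant. *)
Definition Tplus (a : 'I_N) (h : config N) : config N :=
  [ffun n => if n == a then inord (h n).+1 else h n].
Definition Tminus (a : 'I_N) (h : config N) : config N :=
  [ffun n => if n == a then inord (h n).-1 else h n].

Definition interp (lambda : C) (a : 'I_N) (h : config N) : C :=
  \prod_(b < N | b != a)
    (sinh (lambda - xih b (h b)) / sinh (xih a (h a) - xih b (h b))).

Record sov_bases (bra : config N -> 'rV[C]_#|config N|)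
    (ket : config N -> 'cV[C]_#|config N|) : Prop := SovBases {
  sov_bra_basis : basis_of fullv (codom bra);
  sov_ket_basis : basis_of fullv (codom ket);
  sov_pairing : forall h k, pairing (bra h) (ket k) = (h == k)%:R / Vh h;
  sov_bra_D : forall lambda h,
    bra h *m Dop lambda = (\prod_(n < N) sinh (lambda - xih n (h n))) *: bra h;
  sov_bra_C : forall lambda h,
    bra h *m Cop lambda =
    \sum_(a < N) (interp lambda a h * (h a == 0%N :> nat)%:R * dfun (xih a 1%N))
                   *: bra (Tplus a h);
  sov_bra_B : forall lambda h,
    bra h *m Bop lambda =
    - \sum_(a < N) (interp lambda a h * (h a == 1%N :> nat)%:R * afun (xih a 0%N))
                   *: bra (Tminus a h);
  sov_ket_D : forall lambda h,
    Dop lambda *m ket h = (\prod_(n < N) sinh (lambda - xih n (h n))) *: ket h;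
  sov_ket_C : forall lambda h,
    Cop lambda *m ket h =
    \sum_(a < N) (interp lambda a h * (h a == 1%N :> nat)%:R * dfun (xih a 1%N))
                   *: ket (Tminus a h);
  sov_ket_B : forall lambda h,
    Bop lambda *m ket h =
    - \sum_(a < N) (interp lambda a h * (h a == 0%N :> nat)%:R * afun (xih a 0%N))
                   *: ket (Tplus a h)
}.

Definition trigpoly (p : 'I_N -> C) (lambda : C) : C :=
  \prod_(j < N) sinh ((lambda - p j) / 2%:R).

Definition left_separate (bra : config N -> 'rV[C]_#|config N|)
    (P : C -> C) (kappa eps : C) : 'rV[C]_#|config N| :=
  \sum_(h : config N) ((\prod_(n < N) (eps / kappa * (P (xi n) / P (xi n - eta))) ^+ (1 - h n)%N)
          * Vh h) *: bra h.

Definition right_separate (ket : config N -> 'cV[C]_#|config N|)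
    (Q : C -> C) (kappa eps : C) : 'cV[C]_#|config N| :=
  \sum_(h : config N) ((\prod_(n < N) (eps * kappa * (Q (xi n) / Q (xi n - eta))) ^+ (1 - h n)%N)
          * (Vh_compl h / V xi)) *: ket h.

Definition scalar_S (F : C -> C) (alpha : C) : C :=
  \sum_(h : config N)
     (\prod_(n < N) (alpha * (F (xi n) / F (xi n - eta))) ^+ (1 - h n)%N)
     * (Vh_compl h / V xi).

(* Baxter's equation, whose solutions P define the eigenstates.  A trigonometric
   polynomial P which only satisfies it at the points xi_n and xi_n - eta also
   gives an eigenstate, and for exceptional eta, xi there are such P which do
   not solve the functional equation. *)
Definition TQ (tau P : C -> C) : Prop := forall lambda,
  tau lambda * P lambda =
  - afun lambda * P (lambda - eta) + dfun lambda * P (lambda + eta).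

Definition tauhat (tau : C -> C) (lambda : C) : C :=
  cexp lambda * (tau lambda / dfun lambda).

Definition den_mx (tauQ : C -> C) (p : 'I_N -> C) : 'M[C]_N :=
  \matrix_(i, k) (tauQ (xi i) / sinh (xi i - p k)).

Definition num_mx (alpha : C) (tauQ tauP : C -> C) (p : 'I_N -> C) : 'M[C]_N :=
  \matrix_(i, k) (tauQ (xi i) / sinh (xi i - p k)
                  - alpha * (tauP (xi i) / sinh (xi i - p k - eta))).

Definition Smx (alpha : C) (tauQ tauP : C -> C) (z p : 'I_N -> C) : 'M[C]_N :=
  \matrix_(i, k)
    ((tauhat tauQ (z i) - tauhat tauQ (p k)) / sinh (z i - p k)
     - alpha * ((tauhat tauP (z i) - tauhat tauP (p k + eta))
                / sinh (z i - p k - eta))).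

End Chain.

(* Main.v *)
Require Import Defs.
From HB Require Import structures.
From mathcomp Require Import all_boot all_order all_algebra.
From mathcomp Require Import perm complex.
From mathcomp Require Import boolp classical_sets reals sequences exp trigo.
From mathcomp Require Import ring.

Set Implicit Arguments.
Unset Strict Implicit.
Unset Printing Implicit Defensive.

Import Order.TTheory GRing.Theory Num.Theory.

Local Open Scope ring_scope.

(* Put g_k(x) = prod_(l != k) sinh (x - p_l).  The space of trigonometric
   polynomials containing the g_k has dimension N, so det [g_k(x_i)] is V(x)
   times a constant independent of x, and multilinearity in the rows turns the
   sum over h defining S into the determinant of
   g_k(xi_i) + alpha (PQ)(xi_i) / (PQ)(xi_i - eta) g_k(xi_i - eta).
   The separated eigenvalue equation gives
   tau_Q(xi_i) Q(xi_i) = - a(xi_i) Q(xi_i - eta).  Since tau_P is a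
   trigonometric polynomial, the TQ equation shifted by i pi gives
   tau_P(xi_i) P(xi_i + i pi) = a(xi_i) P(xi_i - eta + i pi), and
   prod_k sinh (x - p_k) is a multiple of P(x) P(x + i pi): together these
   produce the first determinant.  For the second, Lagrange interpolation of
   tau_P, tau_Q at the xi_j factors the matrix S(z|p) as a Cauchy matrix in
   (z, xi) times a rescaling of the first matrix. *)

(** * Complex exponential and hyperbolic sine *)

Section Hyperbolic.
Variable R : realType.
Local Notation C := R[i].
Implicit Types x y z : C.

Lemma cexpD x y : cexp (x + y) = cexp x * cexp y.
Proof.
case: x => a b; case: y => c d; rewrite /cexp /= expRD cosD sinD.
by apply/eqP; rewrite eq_complex /=; apply/andP; split; apply/eqP; ring.
Qed.

Lemma cexp0 : cexp (0 : C) = 1.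
Proof.
rewrite /cexp /= expR0 cos0 sin0.
by apply/eqP; rewrite eq_complex /=; apply/andP; split; apply/eqP; ring.
Qed.

Lemma cexp_neq0 x : cexp x != 0.
Proof.
have H : cexp x * cexp (- x) = 1 by rewrite -cexpD subrr cexp0.
by apply: contraTneq (oner_neq0 C) => x0; rewrite -H x0 mul0r eqxx.
Qed.

Lemma cexpN x : cexp (- x) = (cexp x)^-1.
Proof.
by apply: (mulfI (cexp_neq0 x)); rewrite -cexpD subrr cexp0 divff ?cexp_neq0.
Qed.

Lemma cexp_sum (I : finType) (F : I -> C) :
  cexp (\sum_i F i) = \prod_i cexp (F i).
Proof. exact: (big_morph _ cexpD cexp0). Qed.

Lemma cexp_ipi : cexp (ipi R) = -1.
Proof.
rewrite /cexp /ipi /= expR0 cospi sinpi.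
by apply/eqP; rewrite eq_complex /=; apply/andP; split; apply/eqP; ring.
Qed.

Lemma csinhE x : csinh x = (cexp x - (cexp x)^-1) / 2%:R.
Proof. by rewrite /csinh cexpN. Qed.

Lemma csinhN x : csinh (- x) = - csinh x.
Proof. by rewrite /csinh opprK -[RHS]mulNr opprB. Qed.

Lemma csinh0 : csinh (0 : C) = 0.
Proof. by rewrite csinhE cexp0 invr1 subrr mul0r. Qed.

Lemma csinhBC x y : csinh (x - y) = - csinh (y - x).
Proof. by rewrite -csinhN opprB. Qed.

Lemma csinhDipi x : csinh (x + ipi R) = - csinh x.
Proof.
by rewrite !csinhE cexpD cexp_ipi mulrN1 invrN -opprD mulNr.
Qed.

(** The half-angle formula sinh x = 2 sinh(x/2) cosh(x/2), with i cosh(x/2) written as sinh((x + i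
    pi)/2). In the proof [w] is exp(i pi/2) = i, whence the constant 2/i. *)
Lemma csinh_double : exists2 c : C, c != 0 &
  forall x, csinh x = c * (csinh (x / 2%:R) * csinh ((x + ipi R) / 2%:R)).
Proof.
set w := cexp (ipi R / 2%:R).
have w2 : w ^+ 2 = -1.
  by rewrite expr2 -cexpD -splitr cexp_ipi.
have w0 : w != 0 by exact: cexp_neq0.
exists (2%:R / w); first by rewrite mulf_neq0 ?invr_neq0 ?pnatr_eq0.
move=> x; rewrite [(x + _) / _]mulrDl [csinh x]csinhE {1 2}(splitr x)
  !csinhE !cexpD -/w.
have := cexp_neq0 (x / 2%:R); move: (cexp _) => e e0.
have wV : w^-1 = - w.
  by apply: (mulfI w0); rewrite divff // mulrN -expr2 w2 opprK.
rewrite (invfM e e) (invfM e w) wV.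
have -> : 2%:R * - w * ((e - e^-1) / 2%:R * ((e * w - e^-1 * - w) / 2%:R))
   = - (w ^+ 2) * ((e - e^-1) / 2%:R * (e + e^-1)) by field.
by rewrite w2 opprK mul1r; field.
Qed.

(* This turns [V] into a Vandermonde determinant in the [exp (2 x_i)]. *)
Lemma cexp_sqrB x y :
  cexp x ^+ 2 - cexp y ^+ 2 = cexp x * cexp y * 2%:R * csinh (x - y).
Proof.
rewrite csinhE cexpD cexpN; field.
by rewrite !cexp_neq0.
Qed.

(** The prefactor exp(lambda) of [tauhat] is there for this identity: it makes the difference of
    exp(x)/sinh(x - z) and exp(y)/sinh(y - z) proportional to sinh(x - y). *)
Lemma cexp_csinh_subr x y z :
  cexp x * csinh (y - z) - cexp y * csinh (x - z) = - (cexp z * csinh (x - y)).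
Proof.
rewrite !csinhE !cexpD !cexpN; field.
by rewrite !cexp_neq0.
Qed.

End Hyperbolic.

(** * Products over pairs of indices and row scaling of determinants *)

Lemma prod_offdiag (K : comPzRingType) (N : nat) (F : 'I_N -> 'I_N -> K) :
  \prod_(i < N) \prod_(j < N | j != i) F i j
  = (\prod_(i < N) \prod_(j < N | (i < j)%N) F j i)
    * \prod_(i < N) \prod_(j < N | (i < j)%N) F i j.
Proof.
rewrite [X in _ = X * _](exchange_big_dep xpredT) //= -big_split /=.
apply: eq_bigr => i _; rewrite (bigID (fun j : 'I_N => (j < i)%N)) /=.
congr (_ * _); apply: eq_bigl => j; rewrite -val_eqE /=; by case: ltngtP.
Qed.

(** Each index belongs to N - 1 pairs. *)
Lemma prod_triangle_mul (K : comPzRingType) (N : nat) (e : 'I_N -> K) :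
  \prod_(i < N) \prod_(j < N | (i < j)%N) (e j * e i) = \prod_(i < N) e i ^+ N.-1.
Proof.
under eq_bigr do rewrite big_split /=.
rewrite big_split /= -(prod_offdiag (fun i _ => e i)).
apply: eq_bigr => i _; rewrite prodr_const; congr (_ ^+ _).
by rewrite cardC1 card_ord.
Qed.

Lemma det_row_scale (K : comPzRingType) (N : nat) (c : 'I_N -> K)
    (M : 'I_N -> 'I_N -> K) :
  \det (\matrix_(i, k) (c i * M i k)) = (\prod_i c i) * \det (\matrix_(i, k) M i k).
Proof.
have -> : \matrix_(i, k) (c i * M i k)
    = diag_mx (\row_i c i) *m (\matrix_(i, k) M i k).
  by apply/matrixP => i k; rewrite mul_diag_mx !mxE.
by rewrite det_mulmx det_diag; congr (_ * _); apply: eq_bigr => i _; rewrite mxE.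
Qed.

(** * Trigonometric polynomials: interpolation and alternant determinants *)

Section TrigSpan.
Variable R : realType.
Local Notation C := R[i].

(* The span of the N exponentials [exp ((N - 1 - 2 k) lambda)], [0 <= k < N]. *)
Definition trig_span (N : nat) (g : C -> C) : Prop :=
  exists2 G : {poly C}, (size G <= N)%N &
    forall lambda, g lambda * cexp lambda ^+ N.-1 = G.[cexp lambda ^+ 2].

Lemma trig_span_sum (N : nat) (I : finType) (c : I -> C) (g : I -> C -> C) :
  (forall i, trig_span N (g i)) ->
  trig_span N (fun lambda => \sum_i c i * g i lambda).
Proof.
move=> /(_ _)/cid2 gN.
exists (\sum_i c i *: s2val (gN i)).
  apply: (leq_trans (size_sum _ _ _)); apply/bigmax_leqP => i _.
  exact: leq_trans (size_scale_leq _ _) (s2valP (gN i)).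
move=> x; rewrite horner_sum mulr_suml; apply: eq_bigr => i _.
by rewrite hornerZ -(s2valP' (gN i)) mulrA.
Qed.

Lemma trig_span_prod (N : nat) (a : 'I_N) (y : 'I_N -> C) :
  trig_span N (fun lambda => \prod_(b < N | b != a) csinh (lambda - y b)).
Proof.
(* [F b] evaluated at exp(2x) is exp(x) sinh(x - y_b). *)
pose F b := ((cexp (y b))^-1 / 2%:R) *: 'X - (cexp (y b) / 2%:R)%:P.
have card_a : #|[pred b | b != a]| = N.-1 by rewrite cardC1 card_ord.
exists (\prod_(b < N | b != a) F b).
  apply: (leq_trans (size_poly_prod_leq _ _)).
  have sF b : (size (F b) <= 2)%N.
    rewrite (leq_trans (size_polyD _ _)) // geq_max size_polyN.
    rewrite (leq_trans (size_scale_leq _ _)) ?size_polyX //=.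
    exact: leq_trans (size_polyC_leq1 _) _.
  have S2 : (\sum_(b < N | b != a) size (F b) <= N.-1 * 2)%N.
    by rewrite -card_a -sum_nat_const leq_sum.
  apply: (leq_trans (leq_sub2r _ (_ : (_ <= (N.-1 * 2).+1)%N))); first by [].
  rewrite card_a leq_subLR.
  (* The index [a] forces N > 0, so a product of N - 1 linear factors has size at most N. *)
  have := leq_ltn_trans (leq0n a) (ltn_ord a); case: (N) => // n _ /=.
  by rewrite muln2 -addnn addnS.
move=> x; rewrite -card_a -prodr_const horner_prod -big_split /=.
apply: eq_bigr => b _; rewrite /F csinhE cexpD cexpN.
move: (cexp x) (cexp (y b)) (cexp_neq0 x) (cexp_neq0 (y b)) => u v u0 v0.
by rewrite hornerD hornerN hornerZ hornerX hornerC; field; rewrite u0 v0.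
Qed.

(** A shift by i pi leaves exp(2x) fixed and multiplies exp((N - 1)x) by the sign. *)
Lemma trig_spanDipi (N : nat) (g : C -> C) (x : C) :
  trig_span N g -> g (x + ipi R) * (-1) ^+ N.-1 = g x.
Proof.
case=> G _ gG; apply: (mulIf (expf_neq0 N.-1 (cexp_neq0 x))).
by rewrite gG -mulrA -exprMn mulN1r -mulrN1 -cexp_ipi -cexpD gG cexpD cexp_ipi
  mulrN1 sqrrN.
Qed.

(** The difference of the underlying polynomials has size at most N and vanishes at the N points
    exp(2 x_i), which are distinct by [cexp_sqrB]. *)
Lemma trig_span_inj (N : nat) (x : 'I_N -> C) (g h : C -> C) :
  (forall i j, i != j -> csinh (x i - x j) != 0) ->
  trig_span N g -> trig_span N h ->
  (forall i, g (x i) = h (x i)) -> g =1 h.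
Proof.
move=> xinj [G sG gG] [H sH hH] gh y.
have : G - H = 0.
  apply: (@roots_geq_poly_eq0 _ _ [seq cexp (x i) ^+ 2 | i : 'I_N]).
  - apply/allP => _ /mapP[i _ ->].
    by rewrite rootE hornerD hornerN -gG -hH gh subrr.
  - rewrite map_inj_uniq ?enum_uniq // => i j /eqP.
    rewrite -subr_eq0 cexp_sqrB; apply: contraTeq => /xinj.
    apply: mulf_neq0; apply: mulf_neq0; last by rewrite pnatr_eq0.
    exact: (mulf_neq0 (cexp_neq0 _) (cexp_neq0 _)).
  - by rewrite size_map size_enum_ord (leq_trans (size_polyD _ _)) // geq_max
      size_polyN sG.
move/eqP; rewrite subr_eq0 => /eqP GH.
apply: (mulIf (expf_neq0 N.-1 (cexp_neq0 y))).
by rewrite gG hH GH.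
Qed.

Lemma trig_interpolation (N : nat) (x : 'I_N -> C) (g : C -> C) (y : C) :
  (forall i j, i != j -> csinh (x i - x j) != 0) -> trig_span N g ->
  g y = \sum_a g (x a) / (\prod_(b < N | b != a) csinh (x a - x b))
              * \prod_(b < N | b != a) csinh (y - x b).
Proof.
move=> xinj gN; move: y; apply: (trig_span_inj xinj) => //.
  by apply: trig_span_sum => a; exact: trig_span_prod.
move=> i; rewrite (bigD1 i) //= [X in _ + X]big1 ?addr0 => [|a ai].
  rewrite divfK //; apply/prodf_neq0 => b bi.
  by apply: xinj; rewrite eq_sym.
by rewrite [X in _ * X](bigD1 i) 1?eq_sym //= subrr csinh0 mul0r mulr0.
Qed.

Lemma V_neq0_csinh (N : nat) (x : 'I_N -> C) :
  V x != 0 -> forall i j, i != j -> csinh (x i - x j) != 0.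
Proof.
rewrite /V => Vx i j; rewrite neq_ltn.
have H (k l : 'I_N) : (k < l)%N -> csinh (x l - x k) != 0.
  by move=> kl; move/prodf_neq0: Vx => /(_ k isT)/prodf_neq0; exact.
by case/orP => /H //; rewrite csinhBC oppr_eq0.
Qed.

(** Once row i is multiplied by exp((N - 1) x_i), the matrix is a transposed Vandermonde matrix in
    the exp(2 x_i) times the coefficient matrix of the g_k, which does not involve x. The
    exponentials cancel by [prod_triangle_mul]; the powers of 2 come from [cexp_sqrB], one per
    pair. *)
Lemma det_trig_span (N : nat) (g : 'I_N -> C -> C) :
  (forall k, trig_span N (g k)) ->
  exists c, forall x : 'I_N -> C, \det (\matrix_(i, k) g k (x i)) = V x * c.
Proof.
move=> /(_ _)/cid2 gN; pose G k := s2val (gN k).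
exists ((\prod_(i < N) \prod_(j < N | (i < j)%N) 2%:R)
        * \det (\matrix_(j, k < N) (G k)`_j)) => x.
have e0 : \prod_i cexp (x i) ^+ N.-1 != 0.
  by apply/prodf_neq0 => i _; rewrite expf_neq0 ?cexp_neq0.
apply: (mulfI e0); rewrite -det_row_scale.
have -> : \matrix_(i, k) (cexp (x i) ^+ N.-1 * g k (x i))
   = (Vandermonde N (\row_i cexp (x i) ^+ 2))^T *m \matrix_(j, k) (G k)`_j.
  apply/matrixP => i k; rewrite !mxE mulrC (s2valP' (gN k)).
  rewrite (horner_coef_wide _ (s2valP (gN k))); apply: eq_bigr => j _.
  by rewrite !mxE mulrC.
rewrite det_mulmx det_tr det_Vandermonde mulrA mulrA; congr (_ * _).
rewrite -prod_triangle_mul -!big_split /=; apply: eq_bigr => i _.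
rewrite -!big_split /=; apply: eq_bigr => j _.
by rewrite !mxE cexp_sqrB; ring.
Qed.

End TrigSpan.

(** * Separation-of-variables bases: nondegeneracy, coordinates, action of the transfer matrix *)

Section Sov.
Variables (R : realType) (N : nat) (eta : R[i]) (xi : 'I_N -> R[i]).
Local Notation C := R[i].

Lemma sum_enum_rank (T : finType) (F : 'I_#|T| -> C) :
  \sum_j F j = \sum_x F (enum_rank x).
Proof.
by rewrite (reindex (@enum_rank T)) //; exists enum_val => x _;
  rewrite ?enum_rankK ?enum_valK.
Qed.

(** The twist matrix is antidiagonal, so the trace over the auxiliary space selects the two
    off-diagonal blocks. *)
Lemma transfer_twist (kappa lambda : C) :
  transfer eta xi (twist kappa) lambda
  = kappa *: Cop eta xi lambda + kappa^-1 *: Bop eta xi lambda.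
Proof.
have blockE (a : 'I_2) (K : 'M[C]_2) (X : 'M[C]_#|{: 'I_2 * config N}|) :
    aux_block a a (K0 N K *m X) = \sum_b K a b *: aux_block b a X.
  apply/matrixP => s t; rewrite summxE !mxE sum_enum_rank.
  pose F b u := K0 N K (enum_rank (a, enum_val s)) (enum_rank (b, u))
       * X (enum_rank (b, u)) (enum_rank (a, enum_val t)).
  rewrite (eq_bigr (fun x => F x.1 x.2)); last by case.
  rewrite -(pair_bigA _ F) /=.
  apply: eq_bigr => b _; rewrite (bigD1 (enum_val s)) //= big1 => [|u us].
    by rewrite /F !mxE !enum_rankK /= eqxx mulr1n addr0.
  by rewrite /F !mxE !enum_rankK /= eq_sym (negPf us) mulr0n mul0r.
have twistE a b : twist kappa a b
    = (if a == 0 then kappa else kappa^-1) * (a != b)%:R.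
  by rewrite /twist mul_diag_mx !mxE.
rewrite /transfer /tr0 big_ord_recl big_ord1 !blockE.
rewrite !big_ord_recl !big_ord0 !addr0 !twistE /= !mulr0 !scale0r !mulr1.
rewrite add0r addr0; congr (_ *: aux_block _ _ _ + _ *: aux_block _ _ _);
  exact: val_inj.
Qed.

Lemma xih0 n : xih eta xi n 0 = xi n.
Proof. by rewrite /xih mulr0n subr0. Qed.

Lemma xih1 n : xih eta xi n 1 = xi n - eta.
Proof. by rewrite /xih mulr1n. Qed.

Variables (bra : config N -> 'rV[C]_#|config N|).
Variables (ket : config N -> 'cV[C]_#|config N|).
Hypothesis sov : sov_bases eta xi bra ket.

(** Since the inverse of 0 is 0 by convention, a vanishing [Vh h] would make [bra h] orthogonal to
    every [ket k]. These span the space, so [bra h] would be 0, contradicting its membership in a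
    basis. *)
Lemma sov_Vh_neq0 h : Vh eta xi h != 0.
Proof.
apply/eqP => Vh0.
have bra_free : bra h != 0.
  apply: (free_not0 (basis_free (sov_bra_basis sov))).
  exact: codom_f.
move/eqP: bra_free; apply; apply/rowP => j; rewrite !mxE.
pose v : 'cV[C]_#|config N| := delta_mx j 0.
have vS : v \in <<in_tuple (codom ket)>>%VS.
  by rewrite (span_basis (sov_ket_basis sov)) memvf.
have braK k : bra h *m ket k = 0.
  apply/rowP => i; rewrite ord1 !mxE.
  by have := sov_pairing sov h k; rewrite /pairing mxE Vh0 invr0 mulr0.
have : bra h *m v = 0.
  rewrite (coord_span vS) mulmx_sumr big1 // => i _.
  rewrite -scalemxAr; have /codomP[k ->] : (in_tuple (codom ket))`_i \in codom ket.
    exact: mem_nth.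
  by rewrite braK scaler0.
by rewrite /v -colE => /matrixP/(_ 0 0); rewrite !mxE.
Qed.

Lemma Vh_compl_neq0 h : Vh_compl eta xi h != 0.
Proof.
have := sov_Vh_neq0 [ffun n => inord (1 - h n)]; congr (V _ != 0).
by apply/funext => n; rewrite ffunE inordK // ltnS leq_subr.
Qed.

(** At [cfg1] all exponents 1 - h_n of the separate states are 0; at [cfg_flip a] only the one at
    [a] is 1. The coordinates at these configurations are enough to study the eigenvalues. *)
Definition cfg1 : config N := [ffun=> ord_max].
Definition cfg_flip a : config N := [ffun b => if b == a then ord0 else ord_max].

Lemma Tplus_flip a : Tplus a (cfg_flip a) = cfg1.
Proof.
apply/ffunP => b; rewrite !ffunE; case: eqP => // _.
by apply: val_inj; rewrite /= inordK.
Qed.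

Lemma Vh_compl_cfg1 : Vh_compl eta xi cfg1 = V xi.
Proof. by congr V; apply/funext => n; rewrite ffunE xih0. Qed.

Lemma Vh_cfg1 : Vh eta xi cfg1 = V xi.
Proof.
apply: eq_bigr => i _; apply: eq_bigr => j _; rewrite !ffunE !xih1.
by congr csinh; ring.
Qed.

Lemma V_xi_neq0 : V xi != 0.
Proof. by rewrite -Vh_compl_cfg1 Vh_compl_neq0. Qed.

Lemma bra_pairing_sum (c : config N -> C) h :
  pairing (bra h) (\sum_k c k *: ket k) = c h / Vh eta xi h.
Proof.
rewrite /pairing mulmx_sumr summxE (bigD1 h) //= big1 ?addr0 => [|k kh].
  by rewrite -scalemxAr mxE -/(pairing _ _) (sov_pairing sov) eqxx mul1r.
rewrite -scalemxAr mxE -/(pairing _ _) (sov_pairing sov) eq_sym (negPf kh).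
by rewrite mul0r mulr0.
Qed.

Lemma ket_pairing_sum (c : config N -> C) k :
  pairing (\sum_h c h *: bra h) (ket k) = c k / Vh eta xi k.
Proof.
rewrite /pairing mulmx_suml summxE (bigD1 k) //= big1 ?addr0 => [|h hk].
  by rewrite -scalemxAl mxE -/(pairing _ _) (sov_pairing sov) eqxx mul1r.
rewrite -scalemxAl mxE -/(pairing _ _) (sov_pairing sov) (negPf hk).
by rewrite mul0r mulr0.
Qed.

(** The factor [Vh h] carried by the left state cancels the norm 1/[Vh h] of the dual bases, which
    leaves a single sum over h. *)
Lemma pairing_separate (P Q : C -> C) (kappa kappa' eps eps' : C) :
  pairing (left_separate eta xi bra P kappa eps)
          (right_separate eta xi ket Q kappa' eps')
  = scalar_S eta xi (fun x => P x * Q x) (eps * eps' * kappa' / kappa).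
Proof.
rewrite {1}/left_separate /pairing mulmx_suml summxE.
apply: eq_bigr => h _.
rewrite -scalemxAl mxE -/(pairing _ _) bra_pairing_sum.
have /divff VV := sov_Vh_neq0 h.
set u := \prod_n _; set v := \prod_n _.
transitivity (u * v * (Vh_compl eta xi h / V xi) * (Vh eta xi h / Vh eta xi h)).
  by ring.
rewrite VV mulr1; congr (_ * _); rewrite /u /v -big_split /=.
apply: eq_bigr => n _; rewrite -exprMn; congr (_ ^+ _).
by rewrite (invfM (P _) (Q _)); ring.
Qed.

Lemma pairing_bra_transfer (kappa lambda : C) h (v : 'cV[C]_#|config N|) :
  pairing (bra h) (transfer eta xi (twist kappa) lambda *m v)
  = \sum_a interp eta xi lambda a h *
      (kappa * ((h a == 0%N :> nat)%:R * dfun xi (xih eta xi a 1)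
                * pairing (bra (Tplus a h)) v)
       - kappa^-1 * ((h a == 1%N :> nat)%:R * afun eta xi (xih eta xi a 0)
                * pairing (bra (Tminus a h)) v)).
Proof.
rewrite /pairing mulmxA transfer_twist mulmxDr -!scalemxAr.
rewrite (sov_bra_C sov) (sov_bra_B sov) scalerN mulmxBl -!scalemxAl.
have scaleE (c : C) (M : 'M[C]_1) : (c *: M) 0 0 = c * M 0 0 by rewrite mxE.
rewrite !mulmx_suml mxE [X in _ + X]mxE !scaleE !summxE.
rewrite !mulr_sumr -sumrB; apply: eq_bigr => a _ /=.
by rewrite -!scalemxAl !scaleE; ring.
Qed.

End Sov.

(** * Eigenvalues of the transfer matrix: their span and the relation at the nodes *)

Section Eigenstates.
Variables (R : realType) (N : nat) (eta : R[i]) (xi : 'I_N -> R[i]).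
Local Notation C := R[i].
Variables (bra : config N -> 'rV[C]_#|config N|).
Variables (ket : config N -> 'cV[C]_#|config N|).
Hypothesis sov : sov_bases eta xi bra ket.

Lemma trig_span_interp (m : 'I_N -> C) (h : config N) :
  trig_span N (fun lambda => \sum_a interp eta xi lambda a h * m a).
Proof.
pose w (a : 'I_N) :=
  \prod_(b < N | b != a) csinh (xih eta xi a (h a) - xih eta xi b (h b)).
have [G sG gG] := trig_span_sum (fun a => m a / w a)
  (fun a => @trig_span_prod R N a (fun b => xih eta xi b (h b))).
exists G => // lambda; rewrite -gG; congr (_ * _); apply: eq_bigr => a _.
by rewrite /interp prodf_div -/(w a); ring.
Qed.

Lemma trig_span_scaled (e : C) (tau g : C -> C) : e != 0 ->
  (forall lambda, e * tau lambda = g lambda) -> trig_span N g -> trig_span N tau.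
Proof.
move=> e0 taug [G sG gG]; exists (e^-1 *: G).
  exact: leq_trans (size_scale_leq _ _) sG.
by move=> lambda; rewrite hornerZ -gG -taug !mulrA mulVf // mul1r.
Qed.

Lemma right_separate_coord (Q : C -> C) (kappa eps : C) (h : config N) :
  pairing (bra h) (right_separate eta xi ket Q kappa eps)
  = (\prod_(n < N) (eps * kappa * (Q (xi n) / Q (xi n - eta))) ^+ (1 - h n)%N)
    * (Vh_compl eta xi h / V xi) / Vh eta xi h.
Proof. exact: bra_pairing_sum. Qed.

Lemma left_separate_coord (P : C -> C) (kappa eps : C) (h : config N) :
  pairing (left_separate eta xi bra P kappa eps) (ket h)
  = (\prod_(n < N) (eps / kappa * (P (xi n) / P (xi n - eta))) ^+ (1 - h n)%N)
    * Vh eta xi h / Vh eta xi h.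
Proof. exact: ket_pairing_sum. Qed.

(** Pairing the eigenvalue equation with the ket of [cfg1], on which the left state takes the value
    1, writes [eps * tau] as an interpolation sum whose coefficients [m a] do not depend on
    lambda. *)
Lemma trig_span_left_eigenvalue (P tau : C -> C) (kappa eps : C) :
  eps != 0 ->
  left_eigenstate (transfer eta xi (twist kappa))
    (left_separate eta xi bra P kappa eps) (fun lambda => eps * tau lambda) ->
  trig_span N tau.
Proof.
set f := left_separate _ _ _ _ _ _ => eps0 [_ fT].
have f1 : pairing f (ket (cfg1 N)) = 1.
  rewrite left_separate_coord big1 ?mul1r ?divff ?(sov_Vh_neq0 sov) // => n _.
  by rewrite ffunE /= subnn expr0.
pose m a := kappa * ((cfg1 N a == 1%N :> nat)%:R * dfun xi (xih eta xi a 1)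
                * pairing f (ket (Tminus a (cfg1 N))))
       - kappa^-1 * ((cfg1 N a == 0%N :> nat)%:R * afun eta xi (xih eta xi a 0)
                * pairing f (ket (Tplus a (cfg1 N)))).
apply: (@trig_span_scaled eps _ _ eps0 _ (trig_span_interp m (cfg1 N))) => lambda.
have scaleE (c : C) (M : 'M[C]_1) : (c *: M) 0 0 = c * M 0 0 by rewrite mxE.
transitivity (pairing f (transfer eta xi (twist kappa) lambda *m ket (cfg1 N))).
  by rewrite /pairing mulmxA fT -scalemxAl scaleE -/(pairing _ _) f1 mulr1.
rewrite /pairing transfer_twist mulmxDl -!scalemxAl.
rewrite (sov_ket_C sov) (sov_ket_B sov) scalerN mulmxBr -!scalemxAr.
rewrite !mulmx_sumr mxE [X in _ + X]mxE !scaleE !summxE.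
rewrite !mulr_sumr -sumrB; apply: eq_bigr => a _ /=.
by rewrite -!scalemxAr !scaleE /m /pairing; ring.
Qed.

Lemma right_eigenvalue_interp (Q tau : C -> C) (kappa eps lambda : C) h :
  right_eigenstate (transfer eta xi (twist kappa))
    (right_separate eta xi ket Q kappa eps) (fun lambda => eps * tau lambda) ->
  let psi h := pairing (bra h) (right_separate eta xi ket Q kappa eps) in
  eps * tau lambda * psi h
  = \sum_a interp eta xi lambda a h *
      (kappa * ((h a == 0%N :> nat)%:R * dfun xi (xih eta xi a 1)
                * psi (Tplus a h))
       - kappa^-1 * ((h a == 1%N :> nat)%:R * afun eta xi (xih eta xi a 0)
                * psi (Tminus a h))).
Proof.
move=> [_ vT] /=; rewrite -(pairing_bra_transfer sov) vT.
by rewrite /pairing -scalemxAr [RHS]mxE.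
Qed.

Lemma right_separate_coord1 (Q : C -> C) (kappa eps : C) :
  pairing (bra (cfg1 N)) (right_separate eta xi ket Q kappa eps) = (V xi)^-1.
Proof.
rewrite right_separate_coord Vh_compl_cfg1 Vh_cfg1 divff ?(V_xi_neq0 sov) //.
rewrite mulr1 big1 ?mul1r // => n _.
by rewrite ffunE /= subnn expr0.
Qed.

Lemma trig_span_right_eigenvalue (Q tau : C -> C) (kappa eps : C) :
  eps != 0 ->
  right_eigenstate (transfer eta xi (twist kappa))
    (right_separate eta xi ket Q kappa eps) (fun lambda => eps * tau lambda) ->
  trig_span N tau.
Proof.
move=> eps0 vT.
have V0 : (V xi)^-1 != 0 by rewrite invr_neq0 ?(V_xi_neq0 sov).
have e0 : eps / V xi != 0 by exact: mulf_neq0.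
apply: (trig_span_scaled e0 _ (trig_span_interp _ (cfg1 N))) => lambda.
have /= := right_eigenvalue_interp lambda (cfg1 N) vT.
by rewrite right_separate_coord1 mulrAC => ->.
Qed.

(** The factors of V split into those avoiding [a], which agree for x and y by hypothesis, and those
    containing [a], whose signs depend only on the position of [a]. *)
Lemma V_shift_one (a : 'I_N) (x y : 'I_N -> C) :
  (forall i j, i != a -> j != a -> csinh (x j - x i) = csinh (y j - y i)) ->
  V x * \prod_(b < N | b != a) csinh (y a - y b)
  = V y * \prod_(b < N | b != a) csinh (x a - x b).
Proof.
move=> xy.
have VE (t : 'I_N -> C) : V t =
    (\prod_(i < N | i != a) \prod_(j < N | (i < j)%N && (j != a)) csinh (t j - t i))
    * (\prod_(b < N | b != a) (-1) ^+ (a < b)%N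
       * \prod_(b < N | b != a) csinh (t a - t b)).
  rewrite /V (bigD1 a) //=.
  have -> : \prod_(i < N | i != a) \prod_(j < N | (i < j)%N) csinh (t j - t i)
      = \prod_(i < N | i != a)
         ((if (i < a)%N then csinh (t a - t i) else 1)
          * \prod_(j < N | (i < j)%N && (j != a)) csinh (t j - t i)).
    apply: eq_bigr => i ia; case: ifP => lt_ia; first by rewrite (bigD1 a).
    rewrite mul1r; apply: eq_bigl => j; case: eqP => [->|]; rewrite ?andbT //.
    by rewrite lt_ia.
  rewrite -[in RHS]big_split [X in _ * X = _]big_split /= mulrA.
  rewrite [LHS]mulrC; congr (_ * _).
  rewrite [X in X * _](eq_bigl (fun j : 'I_N => (j != a) && (a < j)%N)); last first.
    by move=> j; case: eqVneq => // ->; rewrite ltnn.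
  rewrite big_mkcondr -big_split /=; apply: eq_bigr => b ba.
  case: (ltngtP a b) => [ab|ab|/val_inj ab].
  - by rewrite expr1 mulr1 mulN1r -csinhBC.
  - by rewrite expr0 !mul1r.
  - by rewrite ab eqxx in ba.
rewrite !VE -!mulrA; congr (_ * _); last by ring.
apply: eq_bigr => i ia; apply: eq_bigr => j /andP[_ ja].
exact: xy.
Qed.

Lemma interp_node (a c : 'I_N) (h : config N) :
  interp eta xi (xih eta xi a (h a)) c h = (c == a)%:R.
Proof.
rewrite /interp; case: eqVneq => [->|ca]; last first.
  by rewrite (bigD1 a) 1?eq_sym //= subrr csinh0 !mul0r.
apply: big1 => b ba; rewrite divff //.
by apply: (V_neq0_csinh (sov_Vh_neq0 sov h)); rewrite eq_sym.
Qed.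

(** At lambda = xi_a and h = [cfg_flip a] the interpolation sum keeps only the term [a], which leads
    to [cfg1]. The quotient of [Vh_compl h] by [Vh h] then turns the coefficient d(xi_a - eta) into
    -a(xi_a). *)
Lemma right_eigenvalue_node (Q tau : C -> C) (kappa eps : C) (a : 'I_N) :
  kappa != 0 -> eps ^+ 2 = 1 -> Q (xi a - eta) != 0 ->
  right_eigenstate (transfer eta xi (twist kappa))
    (right_separate eta xi ket Q kappa eps) (fun lambda => eps * tau lambda) ->
  tau (xi a) * Q (xi a) = - afun eta xi (xi a) * Q (xi a - eta).
Proof.
move=> kappa0 eps2 Qa vT.
pose h := cfg_flip a.
have ha : h a = ord0 by rewrite ffunE eqxx.
have hb b : b != a -> h b = ord_max by rewrite ffunE => /negPf->.
have /= := right_eigenvalue_interp (xih eta xi a (h a)) h vT.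
rewrite (bigD1 a) //= big1 ?addr0 => [|c ca]; last first.
  by rewrite interp_node (negPf ca) mul0r.
rewrite interp_node eqxx mul1r ha /= mul0r mul0r mulr0 subr0 mul1r.
rewrite Tplus_flip right_separate_coord1 right_separate_coord xih0 xih1.
rewrite (bigD1 a) //= big1 ?mulr1 => [|b /hb ->]; last by rewrite subnn expr0.
rewrite ha expr1.
pose D := \prod_(b < N | b != a) csinh (xi a - eta - xi b).
pose A := \prod_(b < N | b != a) csinh (xi a - xi b + eta).
have aE : afun eta xi (xi a) = csinh eta * A.
  by rewrite /afun (bigD1 a) //= subrr add0r.
have dE : dfun xi (xi a - eta) = - csinh eta * D.
  by rewrite /dfun (bigD1 a) //= addrAC subrr add0r csinhN.
(* Away from [a] the points of [Vh_compl h] and [Vh h] differ by the common shift eta, so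
   [V_shift_one] compares the two. *)
have VA : Vh_compl eta xi h * A = Vh eta xi h * D.
  transitivity (Vh_compl eta xi h * \prod_(b < N | b != a)
      csinh (xih eta xi a (h a) - xih eta xi b (h b))).
    congr (_ * _); apply: eq_bigr => b ba; rewrite ha hb // xih0 xih1.
    by congr csinh; ring.
  rewrite (@V_shift_one a (fun n => xih eta xi n (1 - h n))) => [|i j ia ja].
    congr (_ * _); apply: eq_bigr => b ba.
    by rewrite ha hb //= xih0 xih1.
  by rewrite !hb //= !xih0 !xih1; congr csinh; ring.
have D0 : D != 0.
  apply/prodf_neq0 => b ba.
  have := V_neq0_csinh (Vh_compl_neq0 sov h); move=> /(_ a b).
  by rewrite eq_sym ha (hb _ ba) /= xih0 xih1; exact.
rewrite aE dE => E.
have Vh0 := sov_Vh_neq0 sov h; have V0 := V_xi_neq0 sov.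
have : tau (xi a) * Q (xi a) * (Vh_compl eta xi h * A)
   = - csinh eta * Q (xi a - eta) * A * D * Vh eta xi h.
  have -> : tau (xi a) * Q (xi a) * (Vh_compl eta xi h * A)
     = (eps * tau (xi a) * (eps * kappa * (Q (xi a) / Q (xi a - eta)) *
         (Vh_compl eta xi h / V xi) / Vh eta xi h))
       * (A * Q (xi a - eta) * V xi * Vh eta xi h / kappa).
    (* The sign enters once through the eigenvalue and once through the coordinate at h. *)
    transitivity (eps ^+ 2 * (tau (xi a) * Q (xi a) * (Vh_compl eta xi h * A))).
      by rewrite eps2 mul1r.
    by field; rewrite kappa0 Qa V0 Vh0.
  by rewrite E; field; rewrite kappa0 V0.
rewrite VA => E2; apply: (mulIf (mulf_neq0 Vh0 D0)); rewrite E2; ring.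
Qed.

End Eigenstates.

(** * Determinant formulas for the overlap *)

Section Overlap.
Variables (R : realType) (N : nat).
Local Notation C := R[i].
Implicit Types (p xi : 'I_N -> C) (eta alpha : C).

(** Clearing denominators row by row gives det g_k(x_i) = V(x) c. The constant c is found at x = y,
    where the matrix is diagonal. *)
Lemma cauchy_det_csinh (x y : 'I_N -> C) :
  V y != 0 -> (forall i k, csinh (x i - y k) != 0) ->
  \det (\matrix_(i, k) (csinh (x i - y k))^-1)
    * (\prod_i \prod_k csinh (x i - y k))
  = V x * \prod_(i < N) \prod_(j < N | (i < j)%N) csinh (y i - y j).
Proof.
move=> Vy xy.
pose g (k : 'I_N) (lambda : C) := \prod_(l < N | l != k) csinh (lambda - y l).
have [c gc] := det_trig_span (fun k => trig_span_prod k y : trig_span N (g k)).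
have -> : \prod_(i < N) \prod_(j < N | (i < j)%N) csinh (y i - y j) = c.
  apply: (mulfI Vy); rewrite -(prod_offdiag (fun i j => csinh (y i - y j))) -gc.
  have -> : \matrix_(i, k) g k (y i) = diag_mx (\row_k g k (y k)).
    apply/matrixP => i k; rewrite !mxE; case: eqVneq => [->|ik]; first by rewrite mulr1n.
    by rewrite /g (bigD1 i) //= subrr csinh0 mul0r.
  by rewrite det_diag; apply: eq_bigr => k _; rewrite mxE.
rewrite -gc mulrC -det_row_scale; congr (\det _); apply/matrixP => i k.
by rewrite !mxE (bigD1 k) //= -/(g k (x i)) mulrAC divff ?mul1r.
Qed.

Lemma det_scalar_S eta xi (g : 'I_N -> C -> C) (F : C -> C) alpha (c : C) :
  V xi != 0 ->
  (forall x, \det (\matrix_(i, k) g k (x i)) = V x * c) ->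
  \det (\matrix_(i, k) (g k (xi i)
       + alpha * (F (xi i) / F (xi i - eta)) * g k (xi i - eta)))
  = scalar_S eta xi F alpha * (V xi * c).
Proof.
move=> V0 gc; pose b i : C := alpha * (F (xi i) / F (xi i - eta)).
(* Each row is a sum over h_i in {0, 1} taken at the point with index 1 - h_i; expanding all rows
   gives one determinant, [Vh_compl h] times c, for each h. *)
have rowE i k : g k (xi i) + b i * g k (xi i - eta)
    = \sum_(h : 'I_2) b i ^+ (1 - h) * g k (xih eta xi i (1 - h)).
  by rewrite !big_ord_recl big_ord0 /= xih0 xih1 expr0 expr1 mul1r addr0 addrC.
rewrite mulr_suml /determinant.
under eq_bigr => s _.
  under eq_bigr do rewrite mxE rowE.
  rewrite (bigA_distr_bigA (fun i (h : 'I_2) => b i ^+ (1 - h)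
    * g ((s : 'S_N) i) (xih eta xi i (1 - h)))) mulr_sumr.
  over.
rewrite exchange_big; apply: eq_bigr => h _ /=.
rewrite mulrA -[X in X * _]mulrA divfK // -mulrA -gc /determinant mulr_sumr.
apply: eq_bigr => s _; rewrite big_split /= mulrCA; congr (_ * (_ * _)).
by apply: eq_bigr => i _; rewrite mxE.
Qed.

Lemma prod_csinh_trigpoly p : exists2 c : C, c != 0 &
  forall x : C, \prod_k csinh (x - p k) = c * (trigpoly p x * trigpoly p (x + ipi R)).
Proof.
have [c c0 cE] := csinh_double R; exists (c ^+ N); first by rewrite expf_neq0.
move=> x; have -> : c ^+ N = \prod_(k < N) c by rewrite prodr_const card_ord.
rewrite /trigpoly -[X in _ = _ * X]big_split -[RHS]big_split /=.
by apply: eq_bigr => k _; rewrite cE addrAC.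
Qed.

Lemma dfun_xi xi i : dfun xi (xi i) = 0.
Proof. by rewrite /dfun (bigD1 i) //= subrr csinh0 mul0r. Qed.

(** At xi_i + i pi the term with d vanishes, a acquires the sign (-1)^N and tau the sign (-1)^(N -
    1); the two signs are opposite, so the minus sign of the TQ equation disappears. *)
Lemma TQ_shift_ipi_node eta xi (tau P : C -> C) i : TQ eta xi tau P -> trig_span N tau ->
  tau (xi i) * P (xi i + ipi R) = afun eta xi (xi i) * P (xi i - eta + ipi R).
Proof.
move=> tq tauN.
have d0 : dfun xi (xi i + ipi R) = 0.
  by rewrite /dfun (bigD1 i) //= addrAC subrr csinhDipi csinh0 oppr0 mul0r.
have aE : afun eta xi (xi i + ipi R) = (-1) ^+ N * afun eta xi (xi i).
  have -> : (-1) ^+ N = \prod_(n < N) (-1) :> C by rewrite prodr_const card_ord.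
  rewrite /afun -[RHS]big_split /=.
  apply: eq_bigr => n _; rewrite mulN1r -csinhDipi; congr csinh; ring.
rewrite -(trig_spanDipi (xi i) tauN) mulrAC tq d0 mul0r addr0 aE.
rewrite [xi i - eta + _]addrAC.
have -> : (-1) ^+ N = - (-1) ^+ N.-1 :> C.
  by rewrite -[in LHS](ltn_predK (ltn_ord i)) exprS mulN1r.
set e := (-1) ^+ N.-1; have e2 : e * e = 1 by rewrite -expr2 sqrr_sign.
set v := P _; transitivity (e * e * (afun eta xi (xi i) * v)); first by ring.
by rewrite e2 mul1r.
Qed.

Lemma det_num_mx eta xi p (Q tauP tauQ : C -> C) alpha :
  let P := trigpoly p in
  V xi != 0 -> trig_span N tauP -> TQ eta xi tauP P ->
  (forall i, tauQ (xi i) * Q (xi i) = - afun eta xi (xi i) * Q (xi i - eta)) ->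
  (forall i, P (xi i - eta) != 0) -> (forall i, Q (xi i - eta) != 0) ->
  (forall i k, csinh (xi i - p k) != 0) ->
  (forall i k, csinh (xi i - p k - eta) != 0) ->
  \det (num_mx eta xi alpha tauQ tauP p)
  = scalar_S eta xi (fun x => P x * Q x) alpha * \det (den_mx xi tauQ p).
Proof.
move=> P V0 tauN tq qrel P0 Q0 xp xpe.
have [c c0 cE] := prod_csinh_trigpoly p.
pose P2 x := \prod_k csinh (x - p k).
pose g (k : 'I_N) (x : C) := \prod_(l < N | l != k) csinh (x - p l).
have [c' gc] := det_trig_span (fun k => trig_span_prod k p : trig_span N (g k)).
have P2E k x : P2 x = csinh (x - p k) * g k x by rewrite /P2 (bigD1 k).
have P2_0 : \prod_i P2 (xi i) != 0.
  by apply/prodf_neq0 => i _; apply/prodf_neq0 => k _.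
(* [P2] is a multiple of P(x) P(x + i pi). The node relation for Q cancels Q(xi_i - eta), the factor
   P(xi_i - eta) cancels directly, and the shifted relation for P brings in tau_P. *)
have ratio i : tauQ (xi i) * (P (xi i) * Q (xi i) / (P (xi i - eta) * Q (xi i - eta)))
    * P2 (xi i - eta) = - tauP (xi i) * P2 (xi i).
  have -> : tauQ (xi i) * (P (xi i) * Q (xi i) / (P (xi i - eta) * Q (xi i - eta)))
     = (tauQ (xi i) * Q (xi i)) * P (xi i) / (P (xi i - eta) * Q (xi i - eta)).
    by ring.
  rewrite qrel /P2 !cE -/P.
  transitivity (- (c * P (xi i)
      * (afun eta xi (xi i) * P (xi i - eta + ipi R)))).
    by field; rewrite P0 Q0.
  by rewrite -(TQ_shift_ipi_node _ tq tauN); ring.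
(* Multiplying row i by [P2 (xi i)] turns 1/sinh(xi_i - p_k) into g_k(xi_i), and by [ratio] the
   tau_P entry becomes the g_k(xi_i - eta) entry of [det_scalar_S]. *)
have numE : (\prod_i P2 (xi i)) * \det (num_mx eta xi alpha tauQ tauP p)
  = (\prod_i tauQ (xi i)) * (scalar_S eta xi (fun x => P x * Q x) alpha * (V xi * c')).
  rewrite -(det_scalar_S eta _ alpha V0 gc) -!det_row_scale; congr (\det _).
  apply/matrixP => i k; rewrite !mxE.
  transitivity (tauQ (xi i) * g k (xi i)
     + alpha * (- tauP (xi i) * P2 (xi i) / csinh (xi i - p k - eta))).
    rewrite mulrBr {1}(P2E k); congr (_ + _); last by ring.
    by rewrite mulrAC mulrCA divff ?mulr1.
  rewrite -ratio (P2E k (xi i - eta)) addrAC.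
  by field; rewrite P0 Q0 xpe.
have denE : (\prod_i P2 (xi i)) * \det (den_mx xi tauQ p)
  = (\prod_i tauQ (xi i)) * (V xi * c').
  rewrite -gc -!det_row_scale; congr (\det _); apply/matrixP => i k; rewrite !mxE.
  by rewrite (P2E k) mulrAC mulrCA divff ?mulr1.
by apply: (mulfI P2_0); rewrite numE mulrCA -denE mulrCA.
Qed.

(** Interpolating tau at the xi_j expands [tauhat] in the functions exp(y)/sinh(y - xi_j). By
    [cexp_csinh_subr] the difference quotient of each one separates z from p. *)
Lemma tauhat_quotient xi (tau : C -> C) (z p : C) :
  V xi != 0 -> trig_span N tau -> dfun xi z != 0 -> dfun xi p != 0 ->
  csinh (z - p) != 0 ->
  (tauhat xi tau z - tauhat xi tau p) / csinh (z - p)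
  = \sum_j (csinh (z - xi j))^-1
      * (cexp (xi j) / (\prod_(b < N | b != j) csinh (xi j - xi b))
         * (tau (xi j) / csinh (xi j - p))).
Proof.
move=> V0 tauN z0 p0 zp.
have xi0 := V_neq0_csinh V0.
have hatE y : dfun xi y != 0 -> tauhat xi tau y
   = \sum_j tau (xi j) / (\prod_(b < N | b != j) csinh (xi j - xi b))
        * (cexp y / csinh (y - xi j)).
  move=> y0; rewrite /tauhat (trig_interpolation y xi0 tauN) mulr_suml mulr_sumr.
  apply: eq_bigr => j _.
  move: y0; rewrite /dfun (bigD1 j) //=.
  set u := csinh _; set v := \prod_(b < N | _) _; set w := \prod_(b < N | _) _.
  move=> uw; have u0 : u != 0 by apply: contraNN uw => /eqP ->; rewrite mul0r.
  have v0 : v != 0 by apply: contraNN uw => /eqP ->; rewrite mulr0.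
  have w0 : w != 0.
    by apply/prodf_neq0 => b bj; apply: xi0; rewrite eq_sym.
  by field; rewrite u0 v0 w0.
rewrite !hatE // -sumrB mulr_suml; apply: eq_bigr => j _.
have zj : csinh (z - xi j) != 0 by move/prodf_neq0: z0; exact.
have pj : csinh (p - xi j) != 0 by move/prodf_neq0: p0; exact.
rewrite (csinhBC (xi j) p).
set w := \prod_(b < N | _) _.
have w0 : w != 0 by apply/prodf_neq0 => b bj; apply: xi0; rewrite eq_sym.
transitivity (tau (xi j) / w * (cexp z * csinh (p - xi j) - cexp p * csinh (z - xi j))
   / (csinh (z - xi j) * csinh (p - xi j)) / csinh (z - p)).
  by field; rewrite zj pj w0 zp.
by rewrite cexp_csinh_subr; field; rewrite zj pj w0 zp.
Qed.

(** The quotients at p_k and at p_k + eta expand over the same nodes with the same factor 1/sinh(z_i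
    - xi_j); what remains is row j of [num_mx], rescaled. *)
Lemma Smx_factor eta xi (z p : 'I_N -> C) (tauP tauQ : C -> C) alpha :
  V xi != 0 -> trig_span N tauP -> trig_span N tauQ ->
  (forall i, dfun xi (z i) != 0) ->
  (forall k, dfun xi (p k) != 0) -> (forall k, dfun xi (p k + eta) != 0) ->
  (forall i k, csinh (z i - p k) != 0) ->
  (forall i k, csinh (z i - p k - eta) != 0) ->
  Smx eta xi alpha tauQ tauP z p
  = (\matrix_(i, j) (csinh (z i - xi j))^-1) *m
    (\matrix_(j, k) (cexp (xi j) / (\prod_(b < N | b != j) csinh (xi j - xi b))
                     * num_mx eta xi alpha tauQ tauP p j k)).
Proof.
move=> V0 tauPN tauQN z0 p0 pe0 zp zpe.
apply/matrixP => i k; rewrite !mxE.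
rewrite (tauhat_quotient V0 tauQN) //.
move: (zpe i k); rewrite -!addrA -!opprD => zpe'.
rewrite (tauhat_quotient V0 tauPN) // mulr_sumr -sumrB.
apply: eq_bigr => j _; rewrite !mxE -!addrA -!opprD; ring.
Qed.

End Overlap.

(* The two determinants carry alpha = eps * eps' * kappa' / kappa, which is
   kappa' / kappa for equal signs.  With kappa' / kappa for opposite signs the
   identities fail already for N = 1, p = q = xi - eta / 2, kappa = kappa',
   where the overlap is 0 and the quotient of determinants is 2. *)
Theorem proposition4p3 (R : realType) (N : nat) (eta : R[i])
  (xi : 'I_N -> R[i])
  (bra : config N -> 'rV[R[i]]_#|config N|)
  (ket : config N -> 'cV[R[i]]_#|config N|)
  (kappa kappa' eps eps' : R[i])
  (p q : 'I_N -> R[i]) (tauP tauQ : R[i] -> R[i]) :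
  let P := trigpoly p in
  let Q := trigpoly q in
  let alpha := eps * eps' * kappa' / kappa in
  let SPQ := scalar_S eta xi (fun lambda => P lambda * Q lambda) alpha in
  let braP := left_separate eta xi bra P kappa eps in
  let ketQ := right_separate eta xi ket Q kappa' eps' in
  (0 < N)%N ->
  ~ commensurate_ipi eta ->
  (forall i j, i != j -> (Xi eta xi i `&` Xi eta xi j = set0)%classic) ->
  sov_bases eta xi bra ket ->
  kappa != 0 -> kappa' != 0 ->
  (eps = 1 \/ eps = -1) -> (eps' = 1 \/ eps' = -1) ->
  (forall n, P (xi n - eta) != 0) -> (forall n, Q (xi n - eta) != 0) ->
  left_eigenstate (transfer eta xi (twist kappa)) braP
    (fun lambda => eps * tauP lambda) ->
  right_eigenstate (transfer eta xi (twist kappa')) ketQ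
    (fun lambda => eps' * tauQ lambda) ->
  TQ eta xi tauP P ->
  [/\ pairing braP ketQ = SPQ,
      (forall i k, csinh (xi i - p k) != 0) ->
      (forall i k, csinh (xi i - p k - eta) != 0) ->
      \det (den_mx xi tauQ p) != 0 ->
      SPQ = \det (num_mx eta xi alpha tauQ tauP p) / \det (den_mx xi tauQ p)
    & forall z : 'I_N -> R[i],
      (forall i, dfun xi (z i) != 0) ->
      (forall k, dfun xi (p k) != 0) ->
      (forall k, dfun xi (p k + eta) != 0) ->
      (forall i k, csinh (z i - p k) != 0) ->
      (forall i k, csinh (z i - p k - eta) != 0) ->
      (forall j, tauQ (xi j) != 0) ->
      (forall i j : 'I_N, (i < j)%N -> csinh (z j - z i) != 0) ->
      (forall i j : 'I_N, (i < j)%N -> csinh (p i - p j) != 0) ->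
      SPQ = ((\prod_(i < N) \prod_(j < N)
              (csinh (z i - xi j) * csinh (xi j - p i)))
           * \det (Smx eta xi alpha tauQ tauP z p))
          / (cexp (\sum_(l < N) xi l) * (\prod_(j < N) tauQ (xi j))
             * \prod_(i < N) \prod_(j < N | (i < j)%N)
                 (csinh (z j - z i) * csinh (p i - p j)))].
Proof.
move=> P Q alpha SPQ braP ketQ _ _ _ sov kappa0 kappa'0 eps1 eps'1.
move=> P0 Q0 eigP eigQ tq.
have sgn_neq0 (e : R[i]) : e = 1 \/ e = -1 -> e != 0.
  by case=> ->; rewrite ?oppr_eq0 oner_eq0.
have V0 := V_xi_neq0 sov.
have tauPN := trig_span_left_eigenvalue sov (sgn_neq0 _ eps1) eigP.
have tauQN := trig_span_right_eigenvalue sov (sgn_neq0 _ eps'1) eigQ.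
have eps'2 : eps' ^+ 2 = 1 by case: eps'1 => ->; rewrite ?sqrrN expr1n.
have qrel i := right_eigenvalue_node sov kappa'0 eps'2 (Q0 i) eigQ.
have numE := det_num_mx alpha V0 tauPN tq qrel P0 Q0.
split; first exact: (pairing_separate sov).
  by move=> xp xpe den0; rewrite numE // mulfK.
move=> z z0 p0 pe0 zp zpe tauQ0 zz pp.
have xp i k : csinh (xi i - p k) != 0.
  by rewrite csinhBC oppr_eq0; move/prodf_neq0: (p0 k); exact.
have xpe i k : csinh (xi i - p k - eta) != 0.
  rewrite -addrA -opprD csinhBC oppr_eq0.
  by move/prodf_neq0: (pe0 k); exact.
have zx i k : csinh (z i - xi k) != 0.
  by move/prodf_neq0: (z0 i); exact.
have Vp : V p != 0.
  apply/prodf_neq0 => i _; apply/prodf_neq0 => j ij.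
  by rewrite csinhBC oppr_eq0; exact: pp.
have Vz : V z != 0.
  by apply/prodf_neq0 => i _; apply/prodf_neq0 => j; exact: zz.
pose W (x : 'I_N -> R[i]) :=
  \prod_(i < N) \prod_(j < N | (i < j)%N) csinh (x i - x j).
have Wp : W p != 0.
  by apply/prodf_neq0 => i _; apply/prodf_neq0 => j; exact: pp.
have Wx : W xi != 0.
  apply/prodf_neq0 => i _; apply/prodf_neq0 => j ij.
  by apply: (V_neq0_csinh V0); rewrite neq_ltn ij.
have cauchy_z := cauchy_det_csinh V0 zx; rewrite -/(W xi) in cauchy_z.
have cauchy_p := cauchy_det_csinh Vp xp; rewrite -/(W p) in cauchy_p.
have tauQ_prod : \prod_j tauQ (xi j) != 0 by apply/prodf_neq0 => j _; exact: tauQ0.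
rewrite (Smx_factor _ V0 tauPN tauQN) // det_mulmx det_row_scale.
(* [den_mx] is the Cauchy matrix in (xi, p) with row j multiplied by tau_Q(xi_j). *)
have -> : \det (\matrix_(i, k) num_mx eta xi alpha tauQ tauP p i k)
    = SPQ * ((\prod_j tauQ (xi j)) * \det (\matrix_(i, k) (csinh (xi i - p k))^-1)).
  rewrite -det_row_scale -/(den_mx xi tauQ p) -numE //; congr (\det _).
  by apply/matrixP => i k; rewrite mxE.
rewrite prodf_div -cexp_sum (prod_offdiag (fun i j => csinh (xi i - xi j))).
rewrite -/(V xi) -/(W xi).
have -> : \prod_(i < N) \prod_(j < N) (csinh (z i - xi j) * csinh (xi j - p i))
   = (\prod_i \prod_j csinh (z i - xi j)) * (\prod_i \prod_k csinh (xi i - p k)).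
  by rewrite [X in _ = _ * X]exchange_big -big_split; apply: eq_bigr => i _;
    rewrite -big_split.
have -> : \prod_(i < N) \prod_(j < N | (i < j)%N)
      (csinh (z j - z i) * csinh (p i - p j)) = V z * W p.
  by rewrite /V /W -[RHS]big_split; apply: eq_bigr => i _; rewrite -[RHS]big_split.
move: cauchy_z cauchy_p (cexp_neq0 (\sum_l xi l)).
set PZ := \prod_i \prod_j _; set PP := \prod_i \prod_k _.
set dZ := \det _; set dP := \det _ => cauchy_z cauchy_p E0.
set E := cexp _ in E0 *; set T := \prod_j _ in tauQ_prod *.
(* Each Cauchy determinant is grouped with its own product: together they give V(z) W(xi) V(xi)
   W(p), where the xi factors cancel those left by the row scaling in [Smx_factor]. *)
transitivity (E / (V xi * W xi) * SPQ * T * (dZ * PZ) * (dP * PP)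
    / (E * T * (V z * W p))).
  by rewrite cauchy_z cauchy_p; field; rewrite V0 Wx Vz Wp E0 tauQ_prod.
by congr (_ / _); ring.
Qed.
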